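(* Let $n\geq 3$. The fibration $q:F_{n+m}(\mathbb{R}P^2)/(S_n\times S_m)\to F_n(\mathbb{R}P^2)/S_n$, which forgets the last $m$ points, admits a cross-section (a continuous map $s$ with $q\circ s=\mathrm{id}$) for $m=kn(2n-1)(2n-2)$ with $k\geq 1$, and for $m=2n(n-1)$.
   Context: $F_k(\Sigma)=\{(p_1,\dots,p_k)\in\Sigma^k: p_i\neq p_j\text{ for } i\neq j\}$ is the ordered configuration space of a surface $\Sigma$; $S_k$ acts by permuting coordinates, and $S_n\times S_m\subset S_{n+m}$ permutes the first $n$ and the last $m$ coordinates separately. The map $q$ sends the class of $(p_1,\dots,p_{n+m})$ to the class of $(p_1,\dots,p_n)$. *)

(* Defs.v *)
From HB Require Import structures.
From mathcomp Require Import all_boot all_order all_algebra all_fingroup.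
From mathcomp Require Import all_classical all_reals all_analysis.

Set Implicit Arguments.
Unset Strict Implicit.
Unset Printing Implicit Defensive.

Import GRing.Theory Num.Theory.
Import numFieldNormedType.Exports.
Local Open Scope classical_set_scope.
Local Open Scope quotient_scope.

Notation sphere2 R :=
  (set_type [set x : 'rV[R]_3 | (\sum_i x ord0 i ^+ 2 = 1)%R]).

Definition antipodal_rel (R : realType) : rel (sphere2 R) :=
  fun x y => (set_val x == set_val y) || (set_val x == - set_val y)%R.

Lemma antipodal_refl (R : realType) : reflexive (@antipodal_rel R).
Proof. by move=> x; rewrite /antipodal_rel eqxx. Qed.

Lemma antipodal_sym (R : realType) : symmetric (@antipodal_rel R).
Proof.
move=> x y; rewrite /antipodal_rel [set_val y == _]eq_sym.
congr (_ || _); apply/eqP/eqP => ->; by rewrite opprK.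
Qed.

Lemma antipodal_trans (R : realType) : transitive (@antipodal_rel R).
Proof.
move=> y x z; rewrite /antipodal_rel.
by case/orP => /eqP ->; case/orP => /eqP ->; rewrite ?opprK eqxx ?orbT.
Qed.

Canonical antipodal_equiv (R : realType) :=
  EquivRel (@antipodal_rel R) (@antipodal_refl R) (@antipodal_sym R)
           (@antipodal_trans R).

Notation RP2 R := (quotient_topology {eq_quot (@antipodal_equiv R)}).

(* F_k(X) = {(p_1,...,p_k) in X^k | p_i <> p_j for i <> j}, subspace of the
   product topology on X^k = ('I_k -> X) *)
Notation conf X k := (set_type [set p : {ptws 'I_k -> X} | injective p]).

Definition orbit_rel (X : topologicalType) (k : nat) (G : {group 'S_k})
  : rel (conf X k) :=
  fun p q => `[< exists2 s, s \in G & forall i, set_val q i = set_val p (s i) >].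

Lemma orbit_refl X k (G : {group 'S_k}) : reflexive (@orbit_rel X k G).
Proof.
by move=> p; apply/asboolP; exists 1%g => [|i]; rewrite ?group1 ?perm1.
Qed.

Lemma orbit_sym X k (G : {group 'S_k}) : symmetric (@orbit_rel X k G).
Proof.
suff H : forall p q, @orbit_rel X k G p q -> @orbit_rel X k G q p.
  by move=> p q; apply/idP/idP => /H.
move=> p q H; have [s sG Hs] := asboolW H; apply/asboolP.
exists s^-1%g; first exact: groupVr.
by move=> i; rewrite Hs permKV.
Qed.

Lemma orbit_trans X k (G : {group 'S_k}) : transitive (@orbit_rel X k G).
Proof.
move=> q p r H1 H2; have [s sG Hs] := asboolW H1; have [t tG Ht] := asboolW H2.
apply/asboolP.
exists (t * s)%g; first exact: groupM.
by move=> i; rewrite Ht Hs permM.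
Qed.

Canonical orbit_equiv X k (G : {group 'S_k}) :=
  EquivRel (@orbit_rel X k G) (@orbit_refl X k G) (@orbit_sym X k G)
           (@orbit_trans X k G).

Notation conf_quot X k G := (quotient_topology {eq_quot (@orbit_equiv X k G)}).

(* S_n x S_m <= S_{n+m}: permutations preserving {1..n} (hence {n+1..n+m});
   this is the setwise stabiliser of the first block under the natural action *)
Definition first_block (n m : nat) : {set 'I_(n + m)} :=
  [set i : 'I_(n + m) | (i < n)%N].

Definition SnxSm (n m : nat) : {group 'S_(n + m)} :=
  ('N(first_block n m | 'P))%G.

Notation unord_conf X n := (conf_quot X n [group of [set: 'S_n]]).

Notation bicol_conf X n m := (conf_quot X (n + m) (SnxSm n m)).

Lemma restr_conf_subproof (X : topologicalType) (n m : nat) (p : conf X (n + m)) :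
  [set p : 'I_n -> X | injective p] (set_val p \o lshift m).
Proof.
case: p => p /= /set_mem Hp i j /= /Hp /(congr1 val) /= H; exact: val_inj.
Qed.

Definition restr_conf (X : topologicalType) (n m : nat) (p : conf X (n + m))
  : conf X n :=
  exist _ (set_val p \o lshift m) (mem_set (@restr_conf_subproof X n m p)).

(* q : F_{n+m}(X)/(S_n x S_m) -> F_n(X)/S_n, class of (p_1..p_{n+m}) |->
   class of (p_1..p_n) (well defined; computed on a representative) *)
Definition forget_last (X : topologicalType) (n m : nat)
  (x : bicol_conf X n m) : unord_conf X n :=
  \pi_(unord_conf X n) (restr_conf (generic_quotient.repr x)).

(* Main.v *)
Require Import Defs.
From HB Require Import structures.
From mathcomp Require Import all_boot all_order all_algebra all_fingroup.
From mathcomp Require Import all_classical all_reals all_analysis.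
From mathcomp Require Import ring lra.
Import numFieldNormedType.Exports.

(* Both values of m are multiples N * 2n(n-1) of the number of ordered pairs
   (p_i, +-x_j), j <> i, where x_1, ..., x_n are unit vectors spanning the lines
   p_1, ..., p_n; so near every p_i one places N points for each of the 2(n-1)
   vectors +-x_j. Stereographic projection from -x_i sends +-x_j to distinct
   nonzero vectors g of the plane tangent to the sphere at x_i, and the new
   points are the lines through x_i + theta^l g with 1 <= l <= N. If theta is a
   small multiple of the product of all 1 - <x_i, x_j>^2, the N copies lie in
   disjoint shells around x_i, and the points around distinct p_i stay apart.
   Changing the signs or the order of the x_i only permutes the new points, so
   the construction descends to the unordered configurations of RP^2; it is
   continuous there because the projection from the sphere to RP^2 is open. *)

Set Implicit Arguments.
Unset Strict Implicit.
Unset Printing Implicit Defensive.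

Import Order.TTheory GRing.Theory Num.Theory.
Local Open Scope ring_scope.

(** * Euclidean inner product and satellite vectors *)

Section DotProduct.
Variables (R : realFieldType) (k : nat).
Implicit Types (u v w x y z : 'rV[R]_k) (a b c t : R).

Definition dot u v : R := \sum_i u ord0 i * v ord0 i.

Lemma dotC u v : dot u v = dot v u.
Proof. by apply: eq_bigr => i _; rewrite mulrC. Qed.

Lemma dotDl u v w : dot (u + v) w = dot u w + dot v w.
Proof. by rewrite -big_split; apply: eq_bigr => i _; rewrite mxE mulrDl. Qed.

Lemma dotZl a u v : dot (a *: u) v = a * dot u v.
Proof. by rewrite mulr_sumr; apply: eq_bigr => i _; rewrite mxE mulrA. Qed.

Lemma dotDr u v w : dot u (v + w) = dot u v + dot u w.
Proof. by rewrite dotC dotDl !(dotC u). Qed.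

Lemma dotZr a u v : dot u (a *: v) = a * dot u v.
Proof. by rewrite dotC dotZl dotC. Qed.

Lemma dotNl u v : dot (- u) v = - dot u v.
Proof. by rewrite -scaleN1r dotZl mulN1r. Qed.

Lemma dotNr u v : dot u (- v) = - dot u v.
Proof. by rewrite dotC dotNl dotC. Qed.

Lemma dot0l v : dot 0 v = 0.
Proof. by rewrite -(scale0r 0) dotZl mul0r. Qed.

Lemma dot0r v : dot v 0 = 0.
Proof. by rewrite dotC dot0l. Qed.

Definition dotE := (dotDl, dotDr, dotZl, dotZr, dotNl, dotNr).

Lemma dot_ge0 u : 0 <= dot u u.
Proof. by apply: sumr_ge0 => i _; rewrite -expr2 sqr_ge0. Qed.

Lemma dot_eq0 u : (dot u u == 0) = (u == 0).
Proof.
apply/eqP/eqP => [/psumr_eq0P h|->]; last exact: dot0l.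
apply/rowP => i; rewrite mxE; apply/eqP.
by rewrite -sqrf_eq0 expr2 h // => j _; rewrite -expr2 sqr_ge0.
Qed.

Lemma dot_gt0 u : (0 < dot u u) = (u != 0).
Proof. by rewrite lt_def dot_ge0 andbT dot_eq0. Qed.

Lemma unit_neq0 u : dot u u = 1 -> u != 0.
Proof. by rewrite -dot_gt0 => ->. Qed.

(** The component of [x] orthogonal to [y] has squared length [1 - <x,y>^2]; in the equality case
    below it vanishes. *)
Lemma unit_dot_le1 x y : dot x x = 1 -> dot y y = 1 -> dot x y ^+ 2 <= 1.
Proof.
move=> x1 y1; have := dot_ge0 (x - dot x y *: y).
by rewrite !dotE x1 y1 (dotC y x); nra.
Qed.

Lemma unit_dot_eq1 x y : dot x x = 1 -> dot y y = 1 -> dot x y ^+ 2 = 1 ->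
  x = dot x y *: y.
Proof.
move=> x1 y1 c1; apply/eqP; rewrite -subr_eq0 -dot_eq0; apply/eqP.
by rewrite !dotE x1 y1 (dotC y x); ring: c1.
Qed.

(* A positive multiple of [x + t g], where [g] is the stereographic
   projection of [y] from [- x] to the plane tangent to the sphere at [x]. *)
Definition satellite x y t := (1 + dot x y) *: x + t *: (y - dot x y *: x).

Lemma satelliteN x y t : satellite (- x) (- y) t = - satellite x y t.
Proof.
rewrite /satellite dotNl dotNr opprK.
by apply/rowP => i; rewrite !mxE; ring.
Qed.

Lemma satellite_normal x y t : dot x x = 1 ->
  dot x (satellite x y t) = 1 + dot x y.
Proof. by move=> x1; rewrite !dotE x1; ring. Qed.

(** * Separation estimates, [D] bounding the squared sines of angles from below *)

Section Separation.
Variable D : R.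
Hypotheses (D_gt0 : 0 < D) (D_le1 : D <= 1).

Let one_plus_gt0 c : D <= 1 - c ^+ 2 -> 0 < 1 + c.
Proof. by move: D_gt0 => D0 dc; nra. Qed.

Lemma satellite_neq0 x y t : dot x x = 1 ->
  D <= 1 - dot x y ^+ 2 -> satellite x y t != 0.
Proof.
move: D_gt0 => D0.
move=> x1 dxy; apply/eqP => /(congr1 (dot x)).
rewrite satellite_normal // dot0r.
by have := one_plus_gt0 dxy; lra.
Qed.

(** With [c = <x,y>], [(y - c x) / (1 + c)] is the stereographic projection of [y] from [- x] to the
    plane through 0 orthogonal to [x]. Its length is the tangent of half the angle between [x] and
    [y]. *)
Let offset x y t := (t / (1 + dot x y)) *: (y - dot x y *: x).

Let satelliteE x y t : 0 < 1 + dot x y ->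
  satellite x y t = (1 + dot x y) *: (x + offset x y t).
Proof.
by move=> c; rewrite scalerDr scalerA mulrCA divff ?mulr1 // gt_eqF.
Qed.

Let offset_orth x y t : dot x x = 1 -> dot x (offset x y t) = 0.
Proof. by move=> x1; rewrite !dotE x1; ring. Qed.

Let offset_norm x y t : dot x x = 1 -> dot y y = 1 -> 0 < 1 + dot x y ->
  dot (offset x y t) (offset x y t) = t ^+ 2 * ((1 - dot x y) / (1 + dot x y)).
Proof.
move=> x1 y1 c; rewrite !dotE x1 y1 (dotC y x); field.
by rewrite gt_eqF.
Qed.

(** The ratio equals both [(1 - c^2) / (1 + c)^2] and [(1 - c)^2 / (1 - c^2)], where [1 + c] and
    [1 - c] are at most 2. *)
Let ratio_bounds c : D <= 1 - c ^+ 2 ->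
  D / 4 <= (1 - c) / (1 + c) /\ (1 - c) / (1 + c) <= 4 / D.
Proof.
move: D_gt0 => D0.
move=> dc; have c0 := one_plus_gt0 dc; split.
  by rewrite ler_pdivlMr // mulrAC ler_pdivrMr //; nra.
by rewrite ler_pdivrMr // mulrAC ler_pdivlMr //; nra.
Qed.

Let offset_small x y t : dot x x = 1 -> dot y y = 1 ->
  D <= 1 - dot x y ^+ 2 -> 0 <= t -> t <= D / 10 ->
  dot (offset x y t) (offset x y t) <= D / 25.
Proof.
move: D_gt0 => D0.
move=> x1 y1 dxy t0 tD; have c0 := one_plus_gt0 dxy.
rewrite offset_norm //; have [h1 h2] := ratio_bounds dxy.
have r0 : 0 <= (1 - dot x y) / (1 + dot x y) by apply: le_trans h1; lra.
apply: (@le_trans _ _ ((D / 10) ^+ 2 * (4 / D))).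
  by apply: ler_pM => //; rewrite ?exprn_ge0 // lerXn2r // nnegrE //; lra.
by rewrite le_eqVlt; apply/orP; left; apply/eqP; field; rewrite gt_eqF.
Qed.

(** Otherwise [x - r z = r v - u]. The left side has squared length
    [(r - <x,z>)^2 + 1 - <x,z>^2 >= D], while boundedness of [r] and smallness of the offsets make
    the right side shorter. *)
Let parallel_absurd x z u v r : dot x x = 1 -> dot z z = 1 ->
  dot x u = 0 -> dot z v = 0 ->
  dot u u <= D / 25 -> dot v v <= D / 25 -> D <= 1 - dot x z ^+ 2 ->
  x + u <> r *: (z + v).
Proof.
move: D_gt0 D_le1 => D0 D1.
move=> x1 z1 xu zv uD vD xzD e.
have := congr1 (fun w => dot w w) e; rewrite /= !dotE x1 z1 xu zv (dotC u x) xu.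
rewrite (dotC v z) zv => er.
have v0 := dot_ge0 v; have u0 := dot_ge0 u.
(* Orthogonality gave [1 + |u|^2 = r^2 (1 + |v|^2)], so [r^2 <= 1 + D / 25]. *)
have r2 : r ^+ 2 <= 26 / 25 by have := sqr_ge0 r; nra.
have e2 : x - r *: z = r *: v - u.
  have -> : r *: v = x + u - r *: z by rewrite e scalerDr addrC addKr.
  by rewrite addrAC addrK.
have := congr1 (fun w => dot w w) e2; rewrite /= !dotE x1 z1 (dotC z x) => e3.
(* This yields [|r v - u|^2 <= 2 r^2 |v|^2 + 2 |u|^2]. *)
have := dot_ge0 (r *: v + u); rewrite !dotE => h.
have rv : r ^+ 2 * dot v v <= 26 / 25 * (D / 25).
  by apply: ler_pM => //; rewrite sqr_ge0.
have := sqr_ge0 (r - dot x z); rewrite (dotC u v) in e3 h; nra.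
Qed.

(** If [z = x], comparing components along [x] forces the offset to vanish, against its positive
    length. Otherwise [z] is a centre with offset 0 and [parallel_absurd] applies. *)
Lemma satellite_not_center x y z t r : dot x x = 1 -> dot y y = 1 ->
  dot z z = 1 -> D <= 1 - dot x y ^+ 2 ->
  z = x \/ D <= 1 - dot x z ^+ 2 -> 0 < t -> t <= D / 10 ->
  satellite x y t <> r *: z.
Proof.
move: D_gt0 => D0.
move=> x1 y1 z1 dxy xz t0 tD; have c0 := one_plus_gt0 dxy.
rewrite satelliteE // => e; case: xz => [zx|xz].
  have := congr1 (dot x) e; rewrite zx dotZr dotDr dotZr x1 offset_orth // => er.
  have {}er : r = 1 + dot x y by lra.
  move: e; rewrite er zx => /scalerI -/(_ (lt0r_neq0 c0)).
  rewrite -[RHS]addr0 => /addrI o0.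
  have := offset_norm t x1 y1 c0; rewrite o0 dot0l.
  have [h _] := ratio_bounds dxy.
  have t2 : 0 < t ^+ 2 by rewrite exprn_gt0.
  have D4 : 0 < D / 4 by lra.
  by nra.
apply: (@parallel_absurd x z (offset x y t) 0 (r / (1 + dot x y))) => //.
- exact: offset_orth.
- exact: dot0r.
- by apply: offset_small => //; rewrite ltW.
- by rewrite dot0l; lra.
- apply: (scalerI (lt0r_neq0 c0)); rewrite e addr0 scalerA mulrCA divff ?mulr1 //.
  exact: lt0r_neq0.
Qed.

Lemma satellite_far_neq x y t x' y' t' r :
  dot x x = 1 -> dot y y = 1 -> dot x' x' = 1 -> dot y' y' = 1 ->
  D <= 1 - dot x y ^+ 2 -> D <= 1 - dot x' y' ^+ 2 -> D <= 1 - dot x x' ^+ 2 ->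
  0 < t -> t <= D / 10 -> 0 < t' -> t' <= D / 10 ->
  satellite x y t <> r *: satellite x' y' t'.
Proof.
move=> x1 y1 x1' y1' d d' dx t0 tD t0' tD'.
have c0 := one_plus_gt0 d; have c0' := one_plus_gt0 d'.
rewrite !satelliteE // => e.
apply: (@parallel_absurd x x' (offset x y t) (offset x' y' t')
  (r * (1 + dot x' y') / (1 + dot x y))) => //; try exact: offset_orth.
- by apply: offset_small => //; rewrite ltW.
- by apply: offset_small => //; rewrite ltW.
- apply: (scalerI (lt0r_neq0 c0)); rewrite e !scalerA; congr (_ *: _).
  by field; rewrite lt0r_neq0.
Qed.

(** The components along [x] fix [r], so the two offsets agree, and hence their squared lengths. *)
Lemma satellite_same_center x y t y' t' r :
  dot x x = 1 -> dot y y = 1 -> dot y' y' = 1 ->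
  D <= 1 - dot x y ^+ 2 -> D <= 1 - dot x y' ^+ 2 ->
  satellite x y t = r *: satellite x y' t' ->
  (t / (1 + dot x y)) *: (y - dot x y *: x) =
    (t' / (1 + dot x y')) *: (y' - dot x y' *: x) /\
  t ^+ 2 * ((1 - dot x y) / (1 + dot x y)) =
    t' ^+ 2 * ((1 - dot x y') / (1 + dot x y')).
Proof.
move=> x1 y1 y1' d d'.
have c0 := one_plus_gt0 d; have c0' := one_plus_gt0 d'.
have xE a u : dot x u = 0 -> dot x (a *: (x + u)) = a.
  by move=> xu; rewrite dotZr dotDr xu x1 addr0 mulr1.
rewrite !satelliteE // scalerA => e.
have := congr1 (dot x) e; rewrite !xE ?offset_orth // => er.
move: e; rewrite -er => /scalerI -/(_ (lt0r_neq0 c0)) /addrI e.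
by split => //; rewrite -!offset_norm // e.
Qed.

(* The squared lengths [(1 - c) / (1 + c)] lie in [[D / 4, 4 / D]], so that
   scalings differing by a factor at most [D / 10] give disjoint shells. *)
Lemma satellite_shell_neq x y t y' t' r :
  dot x x = 1 -> dot y y = 1 -> dot y' y' = 1 ->
  D <= 1 - dot x y ^+ 2 -> D <= 1 - dot x y' ^+ 2 ->
  0 < t -> 0 < t' -> t' <= t * (D / 10) ->
  satellite x y t <> r *: satellite x y' t'.
Proof.
move: D_gt0 => D0.
move=> x1 y1 y1' d d' t0 t0' tt'.
case/satellite_same_center => // _.
have c0 := one_plus_gt0 d; have c0' := one_plus_gt0 d'.
have [h _] := ratio_bounds d; have [h0 h'] := ratio_bounds d'.
have l1 : t ^+ 2 * (D / 4) <= t ^+ 2 * ((1 - dot x y) / (1 + dot x y)).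
  by rewrite ler_wpM2l // sqr_ge0.
have l2 : t' ^+ 2 * ((1 - dot x y') / (1 + dot x y')) <=
    (t * (D / 10)) ^+ 2 * (4 / D).
  apply: ler_pM => //; rewrite ?sqr_ge0 //; first by apply: le_trans h0; lra.
  by rewrite lerXn2r // nnegrE ltW //; apply: lt_le_trans tt'.
have e : (t * (D / 10)) ^+ 2 * (4 / D) = t ^+ 2 * (D / 25).
  by field; rewrite gt_eqF.
have t2 : 0 < t ^+ 2 * D by rewrite mulr_gt0 // exprn_gt0.
by rewrite e in l2; lra.
Qed.

(** Stereographic projection is injective: equal lengths give [<x,y> = <x,y'>], since
    [(1 - c) / (1 + c)] determines [c], and then equal offsets give [y = y']. *)
Lemma satellite_inj x y y' t r :
  dot x x = 1 -> dot y y = 1 -> dot y' y' = 1 ->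
  D <= 1 - dot x y ^+ 2 -> D <= 1 - dot x y' ^+ 2 -> 0 < t ->
  satellite x y t = r *: satellite x y' t -> y = y'.
Proof.
move: D_gt0 => D0.
move=> x1 y1 y1' d d' t0.
case/satellite_same_center => // e n.
have c0 := one_plus_gt0 d; have c0' := one_plus_gt0 d'.
have {n} cc : dot x y = dot x y'.
  have t2 : t ^+ 2 != 0 by rewrite expf_neq0 // gt_eqF.
  move/(mulfI t2): n => /eqP; rewrite eqr_div ?lt0r_neq0 // => /eqP; lra.
move: e; rewrite cc => /scalerI e.
have /e /(addIr _) // : t / (1 + dot x y') != 0.
by rewrite mulf_neq0 ?invr_eq0 // gt_eqF.
Qed.

End Separation.
End DotProduct.

Local Open Scope classical_set_scope.
Local Open Scope quotient_scope.

(** * Box neighbourhoods in finite powers *)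

Section FinitePower.
Variables (I : finType) (T : topologicalType).

(** The filter of boxes converges to [x] for the topology induced by each coordinate, hence for
    their supremum. Conversely, finiteness of [I] makes a box a finite intersection of
    neighbourhoods. *)
Lemma nbhs_ptwsP (x : {ptws I -> T}) (A : set {ptws I -> T}) :
  nbhs x A <-> exists2 P : I -> set T, (forall i, nbhs (x i) (P i)) &
    [set y : {ptws I -> T} | forall i, P i (y i)] `<=` A.
Proof.
split=> [xA|[P xP PA]].
  pose F := filter_from [set P : I -> set T | forall i, nbhs (x i) (P i)]
    (fun P => [set y : {ptws I -> T} | forall i, P i (y i)]).
  have FF : Filter F.
    apply: filter_from_filter => [|P Q xP xQ].
      by exists (fun=> setT) => i; exact: filterT.
    exists (fun i => P i `&` Q i); first by move=> i; apply: filterI.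
    by move=> y PQy; split=> i; have [] := PQy i.
  suff /(_ A xA) [P xP PA] : F --> x by exists P.
  apply/cvg_sup => i B [_ [[C oC <-] Cx CB]].
  exists (fun j => if j == i then C else setT).
    move=> j; case: eqP => [->|_]; last exact: filterT.
    exact: open_nbhs_nbhs.
  by move=> y /(_ i); rewrite eqxx => Cy; apply: CB.
apply: filterS PA _.
apply: (@filter_forall _ _ (fun i (y : {ptws I -> T}) => P i (y i)) _
  (nbhs_filter x)) => i.
exact: (@proj_continuous I (fun=> T) i x _ (xP i)).
Qed.

Lemma cvg_ptws U (F : set_system U) (f : U -> {ptws I -> T})
    (g : {ptws I -> T}) : Filter F ->
  (forall i, (fun u => f u i) @ F --> g i) -> f @ F --> g.
Proof.
move=> FF fg A /nbhs_ptwsP [P gP PA]; rewrite nbhs_filterE /= /nbhs /=.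
apply: filterS (_ : F [set u | forall i, P i (f u i)]).
  by move=> u Pu; apply: PA.
by apply: (@filter_forall _ _ (fun i u => P i (f u i)) _ FF) => i; apply: fg.
Qed.

Lemma eval_ptws_continuous (i : I) :
  continuous (fun x : {ptws I -> T} => x i).
Proof. exact: (@proj_continuous I (fun=> T) i). Qed.

End FinitePower.

(** * Orbits of configurations and the forgetful map *)

Section Orbits.
Variable X : topologicalType.

Lemma conf_inj k (p : conf X k) : injective (set_val p).
Proof. exact: (set_mem (valP p)). Qed.

(** A choice of matching indices is injective because [q] is, hence a permutation; the condition on
    blocks puts it in the stabiliser. *)
Lemma SnxSm_orbit n m (p q : conf X (n + m)) :
  (forall k, exists2 k', set_val q k = set_val p k' & (k < n)%N = (k' < n)%N) ->
  @orbit_rel X (n + m) (SnxSm n m) p q.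
Proof.
move=> h; have {h} /choice [s sE] : forall k, exists k',
    set_val q k = set_val p k' /\ (k < n)%N = (k' < n)%N.
  by move=> k; have [k' ? ?] := h k; exists k'.
have sI : injective s.
  move=> k k' e; apply: (@conf_inj _ q).
  by have [e1 _] := sE k; have [e2 _] := sE k'; rewrite e1 e2 e.
apply/asboolP; exists (perm sI); last by move=> k; rewrite permE; case: (sE k).
by apply/astabsP => k; rewrite /= apermE permE !inE; case: (sE k) => _ ->.
Qed.

Lemma Sn_orbit n (p q : conf X n) :
  (forall i, exists j, set_val q i = set_val p j) ->
  @orbit_rel X n [group of [set: 'S_n]] p q.
Proof.
move=> /choice [s sE]; have sI : injective s.
  by move=> i j e; apply: (@conf_inj _ q); rewrite !sE e.
by apply/asboolP; exists (perm sI) => [|i]; rewrite ?inE // permE.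
Qed.

Lemma orbit_repr k (G : {group 'S_k}) (p : conf X k) :
  exists2 s, s \in G & forall i,
    set_val (generic_quotient.repr (\pi_(conf_quot X k G) p)) i = set_val p (s i).
Proof.
have /eqmodP : \pi_(conf_quot X k G) p =
  \pi_(conf_quot X k G) (generic_quotient.repr (\pi_(conf_quot X k G) p)).
  by rewrite reprK.
by move=> /asboolW.
Qed.

(** The chosen representative differs from [p] by a permutation preserving the first block, which
    only reorders the first [n] points. *)
Lemma forget_last_pi n m (p : conf X (n + m)) :
  @forget_last X n m (\pi_(bicol_conf X n m) p) =
  \pi_(unord_conf X n) (restr_conf p).
Proof.
rewrite /forget_last; set r := generic_quotient.repr _.
have [s sN rE] := orbit_repr (SnxSm n m) p; apply/esym/eqmodP.
apply: Sn_orbit => i.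
have := astabsP sN (lshift m i); rewrite /= apermE !inE /= ltn_ord => si.
exists (Ordinal si); apply: etrans (rE (lshift m i)) _.
by congr (set_val p _); apply: val_inj.
Qed.

End Orbits.

(** * Descending an equivariant extension to a cross-section *)

(* [pr] plays the role of a covering map: a configuration in [X] is extended by
   lifting it to [Y] along the noncontinuous [lift] and applying [ext] there. *)
Section Extension.
Variables (X Y : topologicalType) (n m : nat).
Variables (pr : Y -> X) (lift : X -> Y) (S : set Y).
Variable ext : {ptws 'I_n -> Y} -> {ptws 'I_(n + m) -> X}.

Let lifted (x : 'I_n -> Y) :=
  (forall i, S (x i)) /\ injective (fun i => pr (x i)).

Hypothesis lift_in : forall p, S (lift p).
Hypothesis liftK : cancel lift pr.
Hypothesis pr_open : forall y (A : set Y), S y -> nbhs y A ->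
  nbhs (pr y) [set p | exists z, [/\ A z, S z & pr z = p]].
Hypothesis ext_lshift : forall x i, ext x (lshift m i) = pr (x i).
Hypothesis ext_inj : forall x, lifted x -> injective (ext x).
Hypothesis ext_continuous : forall x, lifted x -> {for x, continuous ext}.
(** This covers reordering the points and changing their lifts at once. *)
Hypothesis ext_equivariant : forall x x', lifted x -> lifted x' ->
  (forall i, exists j, pr (x' i) = pr (x j)) ->
  forall k, exists2 k', ext x' k = ext x k' & (k < n)%N = (k' < n)%N.

Let ext_conf x (lx : lifted x) : conf X (n + m) :=
  exist _ (ext x) (mem_set (ext_inj lx)).

Let lifts (p : conf X n) : {ptws 'I_n -> Y} := fun i => lift (set_val p i).

Let lifts_lifted p : lifted (lifts p).
Proof.
by split=> [i|i j]; [exact: lift_in|rewrite !liftK; exact: conf_inj].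
Qed.

Let section (b : unord_conf X n) : bicol_conf X n m :=
  \pi_(bicol_conf X n m) (ext_conf (lifts_lifted (generic_quotient.repr b))).

Let sectionK b : forget_last (section b) = b.
Proof.
rewrite forget_last_pi -[RHS]reprK; congr (\pi_(unord_conf X n) _).
apply: val_inj; apply/funext => i.
by apply: etrans (ext_lshift _ i) _; rewrite liftK.
Qed.

(** The section can be computed from any lift of any representative; near a given configuration this
    allows lifts close to a fixed one in place of [lift]. *)
Let section_pi (p : conf X n) x (lx : lifted x) :
  (forall i, pr (x i) = set_val p i) ->
  section (\pi_(unord_conf X n) p) = \pi_(bicol_conf X n m) (ext_conf lx).
Proof.
move=> xp; apply/eqmodP; apply: SnxSm_orbit => k.
apply: (ext_equivariant (lifts_lifted _) lx) => i.
have [s _ sE] := orbit_repr [group of [set: 'S_n]] p.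
by exists (s^-1%g i); rewrite liftK sE permKV xp.
Qed.

(** Openness is tested on configurations. The preimage under [ext] contains a box around a lift of
    [p]; by openness of [pr], every configuration near [p] has a lift in that box, and [section_pi]
    evaluates the section there. *)
Let section_continuous : continuous section.
Proof.
apply/continuousP => U oU.
change (open (\pi_(unord_conf X n) @^-1` (section @^-1` U))).
rewrite openE => p Up.
(* The configuration space has the subspace topology, so the preimage of [U] is the trace of an open
   [W] of the full power. *)
have [W oW WU] : open (\pi_(bicol_conf X n m) @^-1` U) by [].
have WE x (lx : lifted x) :
    W (ext x) = U (\pi_(bicol_conf X n m) (ext_conf lx)).
  change (W (ext x) = (\pi_(bicol_conf X n m) @^-1` U) (ext_conf lx)).
  by rewrite -WU.
have lp := lifts_lifted p.
have pE i : pr (lifts p i) = set_val p i by exact: liftK.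
have : nbhs (lifts p) (ext @^-1` W).
  apply: (ext_continuous lp); apply: open_nbhs_nbhs; split => //.
  by rewrite (WE _ lp) -(section_pi lp pE).
case/nbhs_ptwsP => P pP PW.
have : nbhs (set_val p : {ptws 'I_n -> X}) [set q : {ptws 'I_n -> X} |
    forall i, exists z, [/\ P i z, S z & pr z = q i]].
  apply/nbhs_ptwsP; exists (fun i => [set q | exists z,
    [/\ P i z, S z & pr z = q]]) => // i.
  by rewrite -pE; apply: pr_open => //; exact: lp.1.
move/(@initial_continuous (conf X n) _ set_val p).
apply: (@filterS _ _ (nbhs_filter p)) => q /= /choice [w wE].
have lw : lifted w.
  split=> [i|i j]; first by case: (wE i).
  by case: (wE i) => _ _ ->; case: (wE j) => _ _ -> /conf_inj.
rewrite /= (section_pi lw) => [|i]; last by case: (wE i).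
by rewrite -WE; apply: PW => i; case: (wE i).
Qed.

Lemma cross_section_of_extension :
  exists s : unord_conf X n -> bicol_conf X n m,
    continuous s /\ (forall b, @forget_last X n m (s b) = b).
Proof. by exists section. Qed.

End Extension.

(** * Lines in three-space and the projection to the projective plane *)

Section ProjectivePlane.
Variable R : realType.
Implicit Types (v w : 'rV[R]_3) (p : RP2 R).

Lemma sphere2P v : (\sum_i v ord0 i ^+ 2 = 1) = (dot v v = 1).
Proof. by congr (_ = 1); apply: eq_bigr => i _; rewrite expr2. Qed.

(** The value at 0 is an arbitrary unit vector, so that [line_of] is defined on all of
    three-space. *)
Definition normalize v : 'rV[R]_3 :=
  if v == 0 then delta_mx ord0 ord0 else (Num.sqrt (dot v v))^-1 *: v.

Lemma normalize_unit v : dot (normalize v) (normalize v) = 1.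
Proof.
rewrite /normalize; case: eqVneq => [_|v0].
  rewrite /dot (bigD1 ord0) //= big1 ?addr0 => [|i /negbTE i0].
    by rewrite !mxE !eqxx mulr1.
  by rewrite !mxE i0 andbF mulr0.
rewrite dotZl dotZr mulrA -expr2 exprVn sqr_sqrtr ?dot_ge0 // mulVf //.
by rewrite dot_eq0.
Qed.

Lemma normalize_id v : dot v v = 1 -> normalize v = v.
Proof.
by move=> v1; rewrite /normalize (negbTE (unit_neq0 v1)) v1 sqrtr1 invr1 scale1r.
Qed.

Lemma normalize_parallel v : v != 0 ->
  exists2 c, c != 0 & normalize v = c *: v.
Proof.
move=> v0; exists (Num.sqrt (dot v v))^-1.
  by rewrite invr_eq0 gt_eqF // sqrtr_gt0 dot_gt0.
by rewrite /normalize (negbTE v0).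
Qed.

Lemma normalize_sphere v :
  normalize v \in [set x : 'rV[R]_3 | \sum_i x ord0 i ^+ 2 = 1].
Proof. by apply: mem_set; rewrite /= sphere2P normalize_unit. Qed.

Definition line_of v : RP2 R :=
  \pi_(RP2 R) (exist _ (normalize v) (normalize_sphere v) : sphere2 R).

Definition lift_of p : 'rV[R]_3 := set_val (generic_quotient.repr p).

Lemma lift_of_unit p : dot (lift_of p) (lift_of p) = 1.
Proof. by rewrite -sphere2P; exact: (set_mem (valP (generic_quotient.repr p))). Qed.

Lemma line_of_val (x : sphere2 R) : line_of (set_val x) = \pi_(RP2 R) x.
Proof.
congr (\pi_(RP2 R) _); apply: val_inj => /=.
by rewrite normalize_id // -sphere2P; exact: (set_mem (valP x)).
Qed.

Lemma lift_ofK : cancel lift_of line_of.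
Proof. by move=> p; rewrite line_of_val reprK. Qed.

Lemma line_of_eqP v w :
  reflect (line_of v = line_of w)
    ((normalize v == normalize w) || (normalize v == - normalize w)).
Proof. by apply: (iffP idP) => [h|/eqmodP //]; exact/eqmodP. Qed.

Lemma line_of_parallel v w : v != 0 -> w != 0 -> line_of v = line_of w ->
  exists c, v = c *: w.
Proof.
move=> v0 w0 /line_of_eqP h.
have [a a0 va] := normalize_parallel v0; have [b b0 wb] := normalize_parallel w0.
move: h; rewrite va wb => /orP [] /eqP e.
  by exists (a^-1 * b); rewrite -scalerA -e scalerA mulVf // scale1r.
exists (- (a^-1 * b)); rewrite scaleNr -scalerA -scalerN -e.
by rewrite scalerA mulVf // scale1r.
Qed.

Lemma line_ofN v : v != 0 -> line_of (- v) = line_of v.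
Proof.
move=> v0; apply/line_of_eqP; rewrite /normalize oppr_eq0.
by rewrite (negbTE v0) dotNl dotNr opprK scalerN eqxx orbT.
Qed.

Lemma line_of_sign v (b : bool) : v != 0 -> line_of ((-1) ^+ b *: v) = line_of v.
Proof.
by move=> v0; case: b; rewrite /= (expr0, expr1) (scale1r, scaleN1r) ?line_ofN.
Qed.

Lemma line_of_unit_eq v w : dot v v = 1 -> dot w w = 1 ->
  line_of v = line_of w -> exists b : bool, v = (-1) ^+ b *: w.
Proof.
move=> v1 w1 /line_of_parallel [||c e]; rewrite ?unit_neq0 //.
have := v1; rewrite e dotZl dotZr w1 mulr1 -expr2 => /eqP.
rewrite sqrf_eq1 => /orP [] /eqP ->; last by exists true; rewrite expr1.
by exists false; rewrite expr0.
Qed.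

Lemma dot_continuous (T : topologicalType) (f g : T -> 'rV[R]_3) (x : T) :
  {for x, continuous f} -> {for x, continuous g} ->
  {for x, continuous (fun y => dot (f y) (g y))}.
Proof.
move=> cf cg; apply: cvg_big => [|i _]; first exact: add_continuous.
apply: cvgM.
  exact: (continuous_comp cf (@coord_continuous _ _ _ ord0 i (f x))).
exact: (continuous_comp cg (@coord_continuous _ _ _ ord0 i (g x))).
Qed.

Lemma normalize_continuous v : v != 0 -> {for v, continuous normalize}.
Proof.
move=> v0.
have cd : {for v, continuous (fun w => dot w w)} by apply: dot_continuous.
pose f w := (Num.sqrt (dot w w))^-1 *: w.
have cf : {for v, continuous f}.
  apply: (@cvgZ _ _ _ (nbhs v) _ _ id); last exact: cvg_id.
  apply: (@cvgV _ _ (nbhs v) _ (fun w => Num.sqrt (dot w w))); first by rewrite gt_eqF // sqrtr_gt0 dot_gt0.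
  exact: (continuous_comp cd (@sqrt_continuous _ _)).
have nf : \forall w \near v, f w = normalize w.
  have : \forall w \near v, 0 < dot w w.
    by apply: (cvgr_gt (dot v v) cd); rewrite dot_gt0.
  by apply: filterS => w; rewrite dot_gt0 /normalize => /negbTE ->.
have fv : f v = normalize v by rewrite /normalize (negbTE v0).
have : normalize @ v --> f v by apply: cvg_trans (near_eq_cvg nf) cf.
by rewrite fv.
Qed.

Lemma line_of_continuous v : v != 0 -> {for v, continuous line_of}.
Proof.
move=> v0 A; move/pi_continuous => [_ [[B oB <-] Bv BA]].
apply: filterS (_ : nbhs v (normalize @^-1` B)); first by move=> w /= ?; exact: BA.
by apply: normalize_continuous => //; apply: open_nbhs_nbhs.
Qed.

(** The points of the sphere whose line meets an open [B] in a unit vector form the trace of [B]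
    united with [- B], which is open. *)
Lemma line_of_open v (A : set 'rV[R]_3) : dot v v = 1 -> nbhs v A ->
  nbhs (line_of v)
    [set p | exists w, [/\ A w, dot w w = 1 & line_of w = p]].
Proof.
move=> v1; rewrite nbhsE => -[B [oB Bv] BA].
pose C : set (RP2 R) := [set p | exists2 x : sphere2 R, B (set_val x) & \pi_(RP2 R) x = p].
have oC : open C.
  have -> : open C = open (\pi_(RP2 R) @^-1` C) by [].
  exists (B `|` -%R @^-1` B).
    apply: openU => //; apply: open_comp => // x _; exact: opp_continuous.
  apply/seteqP; split => x /=.
    case=> [Bx|Bx]; first by exists x.
    have xS : - set_val x \in [set x : 'rV[R]_3 | \sum_i x ord0 i ^+ 2 = 1].
      apply: mem_set; rewrite /= sphere2P dotNl dotNr opprK -sphere2P.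
      exact: (set_mem (valP x)).
    exists (exist _ (- set_val x) xS) => //; apply/eqmodP.
    by rewrite /= /antipodal_rel /= eqxx orbT.
  case=> y By /eqmodP /=; rewrite /antipodal_rel => /orP [] /eqP e.
    by left; rewrite -e.
  by right; rewrite -[- _]e.
have Cv : C (line_of v).
  exists (exist _ (normalize v) (normalize_sphere v)) => //.
  by change (B (normalize v)); rewrite normalize_id.
apply: filterS (open_nbhs_nbhs (conj oC Cv)) => _ [x Bx <-].
exists (set_val x); split; [exact: BA| |exact: line_of_val].
by rewrite -sphere2P; exact: (set_mem (valP x)).
Qed.

End ProjectivePlane.

(** * Satellites of a system of unit vectors spanning distinct lines *)

Lemma prod_le_factor (R : realFieldType) (I : finType) (P : pred I) (F : I -> R) i :
  P i -> (forall j, P j -> 0 <= F j <= 1) -> \prod_(j | P j) F j <= F i.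
Proof.
move=> Pi F01; rewrite (bigD1 i) //= ler_piMr //; first by case/andP: (F01 i Pi).
by apply: prodr_ile1 => j /andP [Pj _]; exact: F01.
Qed.

Lemma dot_sign (R : realFieldType) k (x : 'rV[R]_k) (b : bool) :
  dot ((-1) ^+ b *: x) ((-1) ^+ b *: x) = dot x x.
Proof. by rewrite dotZl dotZr mulrA -expr2 sqrr_sign mul1r. Qed.

Lemma sqr_dot_sign (R : realFieldType) k (x y : 'rV[R]_k) (b c : bool) :
  dot ((-1) ^+ b *: x) ((-1) ^+ c *: y) ^+ 2 = dot x y ^+ 2.
Proof. by rewrite dotZl dotZr !exprMn !sqrr_sign !mul1r. Qed.

(** Up to a global sign, which does not affect the line, only the relative sign of [x] and [y]
    matters. *)
Lemma satellite_sign (R : realFieldType) k (x y : 'rV[R]_k) t (b c : bool) :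
  satellite ((-1) ^+ b *: x) ((-1) ^+ c *: y) t =
  (-1) ^+ b *: satellite x ((-1) ^+ (b (+) c) *: y) t.
Proof.
case: b; last by rewrite /= !expr0 !scale1r.
rewrite expr1 !scaleN1r -satelliteN; congr satellite.
by rewrite signr_addb expr1 mulN1r scaleNr opprK.
Qed.

Section Spread.
Variables (R : realType) (n : nat).
Implicit Types x : 'I_n -> 'rV[R]_3.

Definition frame x :=
  (forall i, dot (x i) (x i) = 1) /\ injective (fun i => line_of (x i)).

(** The product of the squared sines of the angles between distinct lines: continuous, insensitive
    to signs and order, and below each factor. It serves as [D]. *)
Definition spread x : R := \prod_i \prod_(j | j != i) (1 - dot (x i) (x j) ^+ 2).

Lemma frame_dot x i j : frame x -> j != i ->
  0 < 1 - dot (x i) (x j) ^+ 2 <= 1.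
Proof.
case=> x1 xI ji; have c2 := sqr_ge0 (dot (x i) (x j)).
have c1 := unit_dot_le1 (x1 i) (x1 j).
have c3 : dot (x i) (x j) ^+ 2 != 1.
  apply: contraNneq ji => c3; apply/eqP/xI.
  have e := unit_dot_eq1 (x1 i) (x1 j) c3.
  move/eqP: c3; rewrite sqrf_eq1 => /orP [] /eqP h; rewrite {}h in e.
    by rewrite e scale1r.
  by rewrite e scaleN1r line_ofN // unit_neq0.
have c4 : dot (x i) (x j) ^+ 2 < 1 by rewrite lt_def eq_sym c3.
by apply/andP; split; lra.
Qed.

Lemma spread_gt0 x : frame x -> 0 < spread x.
Proof.
move=> fx; apply: prodr_gt0 => i _; apply: prodr_gt0 => j ji.
by case/andP: (frame_dot fx ji).
Qed.

Let row_bounds x i : frame x ->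
  0 <= \prod_(j | j != i) (1 - dot (x i) (x j) ^+ 2) <= 1.
Proof.
move=> fx; apply/andP; split.
  by apply: prodr_ge0 => j ji; case/andP: (frame_dot fx ji) => /ltW.
by apply: prodr_ile1 => j ji; case/andP: (frame_dot fx ji) => /ltW -> ->.
Qed.

Lemma spread_le1 x : frame x -> spread x <= 1.
Proof. by move=> fx; apply: prodr_ile1 => i _; exact: row_bounds. Qed.

Lemma spread_le x i j : frame x -> j != i ->
  spread x <= 1 - dot (x i) (x j) ^+ 2.
Proof.
move=> fx ji; apply: le_trans (_ : \prod_(j | j != i) (1 - dot (x i) (x j) ^+ 2) <= _).
  by apply: (prod_le_factor (P := xpredT)) => // k _; exact: row_bounds.
apply: (prod_le_factor (F := fun j => 1 - dot (x i) (x j) ^+ 2)) => // k ki.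
by case/andP: (frame_dot fx ki) => /ltW -> ->.
Qed.

(** Shells are numbered from 0; the exponent [l.+1] keeps even the outermost scale within the bound
    [D / 10]. *)
Definition scale x l : R := (spread x / 10) ^+ l.+1.

Lemma scale_gt0 x l : frame x -> 0 < scale x l.
Proof. by move=> fx; rewrite exprn_gt0 // divr_gt0 // spread_gt0. Qed.

Let ratio_le1 x : frame x -> 0 <= spread x / 10 <= 1.
Proof.
move=> fx; have := spread_gt0 fx; have := spread_le1 fx => h1 h2.
by apply/andP; split; lra.
Qed.

Lemma scale_le x l : frame x -> scale x l <= spread x / 10.
Proof.
move=> /ratio_le1 /andP [r0 r1]; rewrite -[leRHS]expr1.
exact: ler_wiXn2l.
Qed.

Lemma scale_step x l l' : frame x -> (l < l')%N ->
  scale x l' <= scale x l * (spread x / 10).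
Proof.
move=> /ratio_le1 /andP [r0 r1] ll'; rewrite /scale -exprSr.
exact: ler_wiXn2l.
Qed.

Definition sat x i j (b : bool) l :=
  satellite (x i) ((-1) ^+ b *: x j) (scale x l).

Section Frame.
Variable x : 'I_n -> 'rV[R]_3.
Hypothesis fx : frame x.

Let x1 i : dot (x i) (x i) = 1 := fx.1 i.

Let s1 (b : bool) j : dot ((-1) ^+ b *: x j) ((-1) ^+ b *: x j) = 1.
Proof. by rewrite dot_sign. Qed.

Let sep i j (b : bool) : i != j ->
  spread x <= 1 - dot (x i) ((-1) ^+ b *: x j) ^+ 2.
Proof.
move=> ij; rewrite -[x i]scale1r -(expr0 (-1)) -[0%N]/(nat_of_bool false).
by rewrite sqr_dot_sign spread_le // eq_sym.
Qed.

Lemma sat_neq0 i j b l : i != j -> sat x i j b l != 0.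
Proof. by move=> ij; apply: (satellite_neq0 (spread_gt0 fx)); rewrite ?sep. Qed.

Lemma sat_not_center i j b l k : i != j ->
  line_of (x k) <> line_of (sat x i j b l).
Proof.
move=> ij /esym /line_of_parallel [||c]; rewrite ?sat_neq0 ?unit_neq0 //.
have ki : x k = x i \/ spread x <= 1 - dot (x i) (x k) ^+ 2.
  by case: (eqVneq k i) => [->|ki]; [left|right; exact: spread_le].
exact: (satellite_not_center (spread_gt0 fx) (spread_le1 fx) (x1 i) (s1 b j)
  (x1 k) (sep b ij) ki (scale_gt0 l fx) (scale_le l fx)).
Qed.

(** The label is recovered in stages: the centre by separation of distinct lines, the shell by the
    length of the offset, and the signed direction by stereographic injectivity. *)
Lemma sat_inj i j b l i' j' b' l' : i != j -> i' != j' ->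
  line_of (sat x i j b l) = line_of (sat x i' j' b' l') ->
  [/\ i = i', j = j', b = b' & l = l'].
Proof.
move=> ij ij' e.
have [c ec] := line_of_parallel (sat_neq0 b l ij) (sat_neq0 b' l' ij') e.
(* Both proportionalities are kept because the shell estimate wants the larger scale on the left. *)
have [c' ec'] := line_of_parallel (sat_neq0 b' l' ij') (sat_neq0 b l ij) (esym e).
have D0 := spread_gt0 fx; have D1 := spread_le1 fx.
case: (eqVneq i' i) => [ii|ii]; last first.
  by case: (satellite_far_neq D0 D1 (x1 i) (s1 b j) (x1 i') (s1 b' j')
    (sep b ij) (sep b' ij') (spread_le fx ii) (scale_gt0 l fx) (scale_le l fx)
    (scale_gt0 l' fx) (scale_le l' fx) ec).
subst i'; case: (ltngtP l l') => ll.
- by case: (satellite_shell_neq D0 (x1 i) (s1 b j) (s1 b' j') (sep b ij)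
    (sep b' ij') (scale_gt0 l fx) (scale_gt0 l' fx) (scale_step fx ll) ec).
- by case: (satellite_shell_neq D0 (x1 i) (s1 b' j') (s1 b j) (sep b' ij')
    (sep b ij) (scale_gt0 l' fx) (scale_gt0 l fx) (scale_step fx ll) ec').
subst l'; have ej := satellite_inj D0 (x1 i) (s1 b j) (s1 b' j') (sep b ij)
  (sep b' ij') (scale_gt0 l fx) ec.
have jj : j = j'.
  apply: fx.2; rewrite -(line_of_sign b) ?unit_neq0 //.
  by rewrite ej line_of_sign ?unit_neq0.
subst j'; split => //.
by have := congr1 (dot (x j)) ej; rewrite !dotZr x1 !mulr1 => /signr_inj.
Qed.

End Frame.

Lemma frame_signed x x' : frame x -> frame x' ->
  (forall i, exists j, line_of (x' i) = line_of (x j)) ->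
  exists s : 'I_n -> 'I_n, exists e : 'I_n -> bool,
    injective s /\ forall i, x' i = (-1) ^+ e i *: x (s i).
Proof.
move=> [x1 xI] [x1' xI'] /choice [s sE].
have /choice [e eE] : forall i, exists b : bool, x' i = (-1) ^+ b *: x (s i).
  by move=> i; exact: line_of_unit_eq.
by exists s, e; split => // i j ij; apply: xI'; rewrite !sE ij.
Qed.

Lemma spread_signed x x' (s : 'I_n -> 'I_n) (e : 'I_n -> bool) :
  injective s -> (forall i, x' i = (-1) ^+ e i *: x (s i)) ->
  spread x' = spread x.
Proof.
move=> sI x'E; rewrite /spread [RHS](reindex_inj sI); apply: eq_bigr => i _.
rewrite [RHS](reindex_inj sI); apply: eq_big => j; first by rewrite (inj_eq sI).
by rewrite !x'E sqr_dot_sign.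
Qed.

(** Pulling out the sign of the centre leaves a relative sign; for fixed [i] and [j] it runs over
    both values as [b] does. *)
Lemma sat_signed x x' (s : 'I_n -> 'I_n) (e : 'I_n -> bool) i j b l :
  injective s -> (forall i, x' i = (-1) ^+ e i *: x (s i)) ->
  sat x' i j b l = (-1) ^+ e i *: sat x (s i) (s j) (e i (+) (b (+) e j)) l.
Proof.
move=> sI x'E; rewrite /sat /scale (spread_signed sI x'E) !x'E.
by rewrite scalerA -signr_addb satellite_sign.
Qed.

Section Continuity.
Variables (T : topologicalType) (f : T -> 'I_n -> 'rV[R]_3) (t : T).
Hypothesis cf : forall i, {for t, continuous (fun u => f u i)}.

Lemma spread_continuous : {for t, continuous (fun u => spread (f u))}.
Proof.
apply: cvg_big => [|i _]; first exact: mul_continuous.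
apply: cvg_big => [|j _]; first exact: mul_continuous.
apply: cvgB; first exact: cvg_cst.
have cd := dot_continuous (@cf i) (@cf j).
exact: (continuous_comp cd (@exprn_continuous R 2 (dot (f t i) (f t j)))).
Qed.

Lemma sat_continuous i j b l : {for t, continuous (fun u => sat (f u) i j b l)}.
Proof.
have cj : {for t, continuous (fun u => (-1) ^+ b *: f u j)}.
  by apply: cvgZ; [exact: cvg_cst|exact: cf].
have cd := dot_continuous (@cf i) cj.
have c10 : {for t, continuous (fun u => spread (f u) / 10)}.
  by apply: cvgM; [exact: spread_continuous|exact: cvg_cst].
have cs := continuous_comp c10 (@exprn_continuous R l.+1 (spread (f t) / 10)).
apply: cvgD.
  by apply: cvgZ; [apply: cvgD; [exact: cvg_cst|exact: cd]|exact: cf].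
apply: cvgZ; first exact: cs.
by apply: cvgB; [exact: cj|apply: cvgZ; [exact: cd|exact: cf]].
Qed.

End Continuity.

End Spread.

(** * Labels of the new points *)

Lemma card_off_diagonal n :
  #|[set ij : 'I_n * 'I_n | ij.1 != ij.2]%SET| = (n * (n - 1))%N.
Proof.
have -> : [set ij : 'I_n * 'I_n | ij.1 != ij.2]%SET =
    (~: [set (i, i) | i : 'I_n])%SET.
  apply/setP => -[i j]; rewrite !inE /=; congr (~~ _).
  by apply/eqP/imsetP => [->|[k _ [-> ->]]] //; exists j.
rewrite cardsCs finset.setCK card_imset; last by move=> i j [].
by rewrite card_prod !card_ord mulnBr muln1.
Qed.

Lemma label_enumeration n N m : m = (n * (n - 1) * 2 * N)%N ->
  exists lab : 'I_m -> 'I_n * 'I_n * bool * 'I_N,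
    [/\ injective lab, forall k, (lab k).1.1.1 != (lab k).1.1.2 &
     forall i j b l, i != j -> exists k, lab k = (i, j, b, l)].
Proof.
move=> mE; pose A := finset.setX (finset.setX [set ij : 'I_n * 'I_n | ij.1 != ij.2]%SET
  [set: bool]%SET) [set: 'I_N]%SET.
have cA : #|A| = m by rewrite !cardsX card_off_diagonal !cardsT card_bool card_ord.
exists (fun k => enum_val (cast_ord (esym cA) k)); split.
- by move=> k k' /enum_val_inj /cast_ord_inj.
- by move=> k; have := enum_valP (cast_ord (esym cA) k); rewrite !inE !andbT.
- move=> i j b l ij; have tA : (i, j, b, l) \in A by rewrite !inE ij.
  exists (cast_ord cA (enum_rank_in tA (i, j, b, l))).
  by rewrite cast_ordK enum_rankK_in.
Qed.

(** * The extended configuration *)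

Section Extension.
Variables (R : realType) (n N m : nat).
Variable lab : 'I_m -> 'I_n * 'I_n * bool * 'I_N.
Hypothesis lab_inj : injective lab.
Hypothesis lab_neq : forall k, (lab k).1.1.1 != (lab k).1.1.2.
Hypothesis lab_onto : forall i j b l, i != j -> exists k, lab k = (i, j, b, l).
Implicit Types x : 'I_n -> 'rV[R]_3.

Definition extension x (k : 'I_(n + m)) : RP2 R :=
  match fintype.split k with
  | inl i => line_of (x i)
  | inr k' => let: (i, j, b, l) := lab k' in line_of (sat x i j b l)
  end.

Lemma extension_lshift x i : extension x (lshift m i) = line_of (x i).
Proof. by rewrite /extension (unsplitK (inl i)). Qed.

Lemma extension_rshift x k i j b l : lab k = (i, j, b, l) ->
  extension x (rshift n k) = line_of (sat x i j b l).
Proof. by move=> kE; rewrite /extension (unsplitK (inr k)) kE. Qed.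

Lemma extension_inj x : frame x -> injective (extension x).
Proof.
move=> fx k k'; case: (split_ordP k) => i ->; case: (split_ordP k') => i' ->.
- by rewrite !extension_lshift => /fx.2 ->.
- case E' : (lab i') => [[[a' b'] c'] d'].
  have ab' := lab_neq i'; rewrite E' /= in ab'.
  by rewrite extension_lshift (extension_rshift _ E') => /(sat_not_center fx ab').
- case E : (lab i) => [[[a b] c] d]; have ab := lab_neq i; rewrite E /= in ab.
  by rewrite extension_lshift (extension_rshift _ E) => /esym /(sat_not_center fx ab).
case E : (lab i) => [[[a b] c] d]; have ab := lab_neq i; rewrite E /= in ab.
case E' : (lab i') => [[[a' b'] c'] d']; have ab' := lab_neq i'; rewrite E' /= in ab'.
rewrite (extension_rshift _ E) (extension_rshift _ E').
case/(sat_inj fx ab ab') => aa bb cc /val_inj dd; congr rshift.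
by apply: lab_inj; rewrite E E' aa bb cc dd.
Qed.

Lemma extension_continuous (x : {ptws 'I_n -> 'rV[R]_3}) : frame x ->
  {for x, continuous (extension : {ptws 'I_n -> 'rV[R]_3} -> {ptws 'I_(n + m) -> RP2 R})}.
Proof.
move=> fx; apply: (cvg_ptws (nbhs_filter x)) => k.
have ce i : {for x, continuous (fun y : {ptws 'I_n -> 'rV[R]_3} => y i)}.
  exact: eval_ptws_continuous.
case: (split_ordP k) => i ->.
  rewrite extension_lshift (funext (extension_lshift^~ i)).
  have ci := @line_of_continuous R (x i) (unit_neq0 (fx.1 i)).
  exact: (continuous_comp (@ce i) ci).
case E : (lab i) => [[[a b] c] d]; have ab := lab_neq i; rewrite E /= in ab.
rewrite (extension_rshift _ E) (funext (fun y => extension_rshift y E)).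
have ci := @line_of_continuous R _ (sat_neq0 fx c d ab).
exact: (continuous_comp (@sat_continuous _ _ _ _ _ ce a b c d) ci).
Qed.

Lemma extension_equivariant x x' : frame x -> frame x' ->
  (forall i, exists j, line_of (x' i) = line_of (x j)) ->
  forall k, exists2 k', extension x' k = extension x k' & (k < n)%N = (k' < n)%N.
Proof.
move=> fx fx' xx k; case: (split_ordP k) => i ->.
  have [j ij] := xx i; exists (lshift m j); last by rewrite /= !ltn_ord.
  by rewrite !extension_lshift.
have [s [e [sI x'E]]] := frame_signed fx fx' xx.
case E : (lab i) => [[[a b] c] d]; have ab := lab_neq i; rewrite E /= in ab.
have sab : s a != s b by rewrite (inj_eq sI).
(* This sign is the one produced by [sat_signed]; the shell is unchanged. *)
have [k' k'E] := lab_onto (e a (+) (c (+) e b)) d sab.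
exists (rshift n k'); last by rewrite /= !ltnNge !leq_addr.
rewrite (extension_rshift _ E) (extension_rshift _ k'E) (sat_signed _ _ _ _ sI x'E).
by rewrite line_of_sign // sat_neq0.
Qed.

End Extension.

(** * Cross-sections for multiples of [2n(n-1)] *)

Theorem cross_section_exists (R : realType) (n N m : nat) :
  m = (n * (n - 1) * 2 * N)%N ->
  exists s : unord_conf (RP2 R) n -> bicol_conf (RP2 R) n m,
    continuous s /\ (forall b, @forget_last (RP2 R) n m (s b) = b).
Proof.
case/label_enumeration => lab [labI labN labS].
apply: (cross_section_of_extension (@lift_of_unit R) (@lift_ofK R)
  (@line_of_open R) (extension_lshift lab) (extension_inj labI labN)
  (extension_continuous labN) (extension_equivariant labN labS)).
Qed.

Theorem theoremD (R : realType) (n m : nat) :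
  (3 <= n)%N ->
  ((exists2 k : nat, (1 <= k)%N & m = (k * n * (2 * n - 1) * (2 * n - 2))%N)
   \/ m = (2 * n * (n - 1))%N) ->
  exists s : unord_conf (RP2 R) n -> bicol_conf (RP2 R) n m,
    continuous s /\ (forall b, @forget_last (RP2 R) n m (s b) = b).
Proof.
move=> _ mE; have [N] : exists N, m = (n * (n - 1) * 2 * N)%N.
  case: mE => [[k _ ->]|->]; last by exists 1%N; ring.
  (* The second factor [2n - 2] supplies [2(n - 1)], leaving [k(2n - 1)] points per signed
     direction. *)
  exists (k * (2 * n - 1))%N.
  have -> : (2 * n - 2 = 2 * (n - 1))%N by rewrite mulnBr.
  by ring.
exact: cross_section_exists.
Qed.
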